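(* For all integers $m,n\ge 0$, $b_0(m,n)\ge b_0(m+2,n)$.
   Context: A plane partition $\pi=(\pi_{i,j})_{i,j\ge 1}$ is an array of nonnegative integers, only finitely many nonzero, with $\pi_{i,j}\ge\pi_{i+a,j+b}$ for all $i,j\ge1$, $a,b\ge 0$. Let $w_-(\pi)=\sum_{i<j}\pi_{i,j}$, $w_0(\pi)=\sum_{i=j}\pi_{i,j}$, $w_+(\pi)=\sum_{i>j}\pi_{i,j}$ and $w(\pi)=w_-(\pi)+w_0(\pi)+w_+(\pi)$. For integers $\ell$ and $n\ge 0$, $b_0(\ell,n)$ is the number of plane partitions $\pi$ with $w(\pi)=n$ and $w_-(\pi)-w_+(\pi)=\ell$. *)

(* Defs.v *)
From HB Require Import structures.
From mathcomp Require Import all_boot all_order all_algebra.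
From mathcomp Require Import finmap.
From mathcomp Require Import boolp classical_sets functions cardinality.

Set Implicit Arguments.
Unset Strict Implicit.
Unset Printing Implicit Defensive.

Import Order.TTheory GRing.Theory Num.Theory.
Local Open Scope nat_scope.

(* Arrays of naturals with finitely many nonzero entries.  Rows and columns are
   numbered from 0 instead of 1; the comparisons of i with j below are
   unaffected by this shift. *)
Notation array := {fsfun nat * nat -> nat with 0}.

Definition plane_partition (p : array) : Prop :=
  forall i j a b : nat, p (i + a, j + b) <= p (i, j).

Definition wminus (p : array) : nat :=
  \sum_(x <- finsupp p | x.1 < x.2) p x.
Definition wzero (p : array) : nat :=
  \sum_(x <- finsupp p | x.1 == x.2) p x.
Definition wplus (p : array) : nat :=
  \sum_(x <- finsupp p | x.1 > x.2) p x.
Definition weight (p : array) : nat := wminus p + wzero p + wplus p.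

Definition b0_set (l : int) (n : nat) : set array :=
  [set p | [/\ plane_partition p, weight p = n
             & ((wminus p)%:Z - (wplus p)%:Z)%R = l]]%classic.

(* [fset_set A] is empty when [A] is infinite; [finite_b0_set] below shows that
   this does not happen here. *)
Definition b0 (l : int) (n : nat) : nat := #|` fset_set (b0_set l n)|%fset.

Lemma weightE (p : array) : weight p = \sum_(x <- finsupp p) p x.
Proof.
rewrite /weight /wminus /wzero /wplus -addnA [RHS](bigID (fun x => x.1 < x.2)) /=.
congr (_ + _); rewrite [RHS](bigID (fun x => x.1 == x.2)) /=.
by congr (_ + _); apply: eq_bigl => -[i j] /=; case: ltngtP.
Qed.

Lemma weight_sub (p : array) (s : seq (nat * nat)) :
  uniq s -> {subset s <= finsupp p} -> \sum_(x <- s) p x <= weight p.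
Proof.
move=> us ss; rewrite weightE [leqRHS](bigID (mem s)) /= -[X in _ <= X + _]big_filter.
apply: leq_trans (leq_addr _ _); rewrite (perm_big [seq x <- finsupp p | x \in s]) //.
apply: uniq_perm => //; first by rewrite filter_uniq // fset_uniq.
by move=> x; rewrite mem_filter; case xs: (x \in s) => //=; rewrite ss.
Qed.

Lemma plane_partition_bound (p : array) (i j : nat) : plane_partition p ->
  (i, j) \in finsupp p -> [/\ i < weight p, j < weight p & p (i, j) <= weight p].
Proof.
move=> pp; rewrite mem_finsupp -lt0n => pij.
have pos i' j' : i' <= i -> j' <= j -> 0 < p (i', j').
  move=> /subnKC ei /subnKC ej; apply: leq_trans pij _.
  by rewrite -[in leqLHS]ei -[in leqLHS]ej; apply: pp.
have bound (s : seq (nat * nat)) : uniq s ->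
    (forall x, x \in s -> x.1 <= i /\ x.2 <= j) -> size s <= weight p.
  move=> us hs; apply: leq_trans (weight_sub us _); last first.
    by move=> [i' j'] /hs[li lj]; rewrite mem_finsupp -lt0n pos.
  rewrite -sum1_size big_seq [leqRHS]big_seq.
  by apply: leq_sum => -[i' j'] /hs[li lj]; apply: pos.
split.
- have := bound [seq (k, 0) | k <- iota 0 i.+1]; rewrite size_map size_iota; apply.
    by rewrite map_inj_uniq ?iota_uniq // => ? ? [].
  by move=> x /mapP[k]; rewrite mem_iota => /andP[_ lk] ->.
- have := bound [seq (0, k) | k <- iota 0 j.+1]; rewrite size_map size_iota; apply.
    by rewrite map_inj_uniq ?iota_uniq // => ? ? [].
  by move=> x /mapP[k]; rewrite mem_iota => /andP[_ lk] ->.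
- have := @weight_sub p [:: (i, j)]; rewrite big_seq1; apply=> // x.
  by rewrite inE => /eqP->; rewrite mem_finsupp -lt0n.
Qed.

Lemma finite_b0_set (l : int) (n : nat) : finite_set (b0_set l n).
Proof.
pose B := [fset (nat_of_ord x.1, nat_of_ord x.2) | x in {: 'I_n.+1 * 'I_n.+1}]%fset.
pose F (f : {ffun 'I_n.+1 * 'I_n.+1 -> 'I_n.+1}) : array :=
  [fsfun x in B => f (inord x.1, inord x.2) : nat | 0].
apply: (@sub_finite_set _ _ (F @` setT)%classic); last first.
  by apply: finite_image; apply: finite_finset.
move=> p [pp wp _]; exists [ffun x => inord (p (val x.1, val x.2))] => //.
apply/fsfunP => -[i j]; rewrite fsfunE /=.
have [pij|/(plane_partition_bound pp)[]] := finsuppP p (i, j); rewrite ?wp.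
  case: ifPn => // /imfsetP[/= [x y] _ [ei ej]]; move: pij; rewrite ei ej => pij.
  by rewrite ffunE /= !inordK // fsfun_dflt // inordK.
move=> /ltnW lei /ltnW lej lep; rewrite ffunE /= !inordK //.
case: ifPn => // /negP[]; apply/imfsetP.
by exists (inord i, inord j) => //=; rewrite !inordK.
Qed.

(* Main.v *)
(** Write D_k for the diagonal (p(i, i+k))_i (k >= 0) or (p(i-k, i))_i (k <= 0)
    of a plane partition p.  Neighbouring diagonals interlace, and Fomin's local
    growth rule turns them into an array A of naturals (this is RSK) such that
    w_-, w_0, w_+ become the sums of j A(i,j), A(i,j), i A(i,j).  So b0(l, n)
    counts the monomials prod x_ij^A(i,j) with sum (i+j+1) A(i,j) = n and
    sum (j-i) A(i,j) = l.  Treating x_ij like u^i v^j, the derivations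
    E = v d/du and F = u d/dv make the polynomials of degree n in the first
    grading an sl_2-module whose weight is the second grading.  On the weight
    spaces of positive weight F is injective, hence dim V_(m+2) <= dim V_m. *)

Require Import Defs.
From mathcomp Require Import all_boot all_order all_algebra.
From mathcomp Require Import finmap zify ring.
From mathcomp Require Import boolp classical_sets functions cardinality.

Set Implicit Arguments.
Unset Strict Implicit.
Unset Printing Implicit Defensive.

Import Order.TTheory GRing.Theory Num.Theory.
Local Open Scope nat_scope.

(** * Growth diagrams *)

(** For partitions this says that the skew shape a / b is a horizontal strip. *)
Definition interlace (a b : nat -> nat) : Prop :=
  forall i, b i <= a i /\ a i.+1 <= b i.

(** Fomin's local rule on one cell with entry [m]: [a] is the corner nearest the origin and [d] the
    opposite one. It can be solved both ways, for [d] and [m] from [a], [b], [c], or for [a] from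
    the rest. *)
Definition growth_rule (a b c d : nat -> nat) (m : nat) : Prop :=
  a 0 = maxn (b 0) (c 0) + m /\
  forall i, d i + a i.+1 = minn (b i) (c i) + maxn (b i.+1) (c i.+1).

Definition growth (L : nat -> nat -> nat -> nat) (m : nat -> nat -> nat) : Prop :=
  forall r k, [/\ interlace (L r k) (L r.+1 k), interlace (L r k) (L r k.+1) &
    growth_rule (L r k) (L r.+1 k) (L r k.+1) (L r.+1 k.+1) (m r k)].

Definition vanishing (N : nat) (L : nat -> nat -> nat -> nat) : Prop :=
  forall r k, N <= maxn r k -> L r k 0 = 0.

(** Interlacing bounds entry [i.+1] at (r, k) by entry [i] at either next vertex; stepping along the
    larger coordinate trades one unit of index for one unit of [maxn r k]. *)
Lemma vanishing_entry N L m r k i : growth L m -> vanishing N L ->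
  N <= maxn r k + i -> L r k i = 0.
Proof.
move=> gL vL; elim: i r k => [|i IH] r k leN; first by apply: vL; rewrite addn0 in leN.
have [ir ik _] := gL r k.
case: (leqP r k) => le_rk.
  have := IH r k.+1; have [_] := ik i; lia.
have := IH r.+1 k; have [_] := ir i; lia.
Qed.

(** All partitions far out are empty, and the rule recovers the corner nearest the origin from the
    other three, so the diagram is filled in backwards towards (0, 0). *)
Lemma growth_unique_matrix N L L' m : growth L m -> growth L' m ->
  vanishing N L -> vanishing N L' -> forall r k i, L r k i = L' r k i.
Proof.
move=> gL gL' vL vL'.
(* [a] and [b] bound the distances from [r] and [k] to the vanishing region. *)
have main a b : forall r k, N <= r + a -> N <= k + b -> forall i, L r k i = L' r k i.
  elim: a b => [|a IHa] b r k lea leb i.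
    by rewrite (vanishing_entry gL vL) ?(vanishing_entry gL' vL') //; lia.
  elim: b r k lea leb i => [|b IHb] r k lea leb i.
    by rewrite (vanishing_entry gL vL) ?(vanishing_entry gL' vL') //; lia.
  have [_ _ [e1 e2]] := gL r k; have [_ _ [f1 f2]] := gL' r k.
  have h1 := IHa b.+1 r.+1 k; have h2 := IHb r k.+1; have h3 := IHa b r.+1 k.+1.
  case: i => [|i].
    have := h1 ltac:(lia) ltac:(lia) 0; have := h2 ltac:(lia) ltac:(lia) 0; lia.
  have := e2 i; have := f2 i.
  rewrite !h1 ?h2 ?h3; lia.
by move=> r k i; apply: (main N N); lia.
Qed.

(** Solved for [d], the rule propagates row 0 and column 0 to the whole diagram; the first parts
    around a cell then give its entry. *)
Lemma growth_unique_boundary L L' m m' : growth L m -> growth L' m' ->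
  (forall k i, L 0 k i = L' 0 k i) -> (forall r i, L r 0 i = L' r 0 i) ->
  forall r k, m r k = m' r k.
Proof.
move=> gL gL' row col.
have main r k : forall i, L r k i = L' r k i.
  elim: r k => [|r IHr] k i //; elim: k i => [|k IHk] i //.
  have [_ _ [_ /(_ i) e]] := gL r k; have [_ _ [_ /(_ i) f]] := gL' r k.
  move: e f; rewrite !IHr !IHk; lia.
move=> r k; have [_ _ [+ _]] := gL r k; have [_ _ [+ _]] := gL' r k.
rewrite !main; lia.
Qed.

(** Nested recursion, on the row and then along it, so that [gridS] holds by computation. *)
Fixpoint grid (T : Type) (step : nat -> nat -> T -> T -> T -> T) (row col : nat -> T)
    (r : nat) : nat -> T :=
  if r is r'.+1 then
    fix grid_row k :=
      if k is k'.+1 then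
        step r' k' (grid step row col r' k') (grid_row k') (grid step row col r' k'.+1)
      else col r
  else row.

Lemma gridS T step row col r k : @grid T step row col r.+1 k.+1 =
  step r k (grid step row col r k) (grid step row col r.+1 k) (grid step row col r k.+1).
Proof. by []. Qed.

(** The growth rule solved for [d]. Under interlacing the subtraction is exact, since [a i.+1] is at
    most [b i] and [c i]. *)
Definition rule_down (a b c : nat -> nat) (i : nat) : nat :=
  minn (b i) (c i) + maxn (b i.+1) (c i.+1) - a i.+1.

Definition rule_up (d b c : nat -> nat) (m i : nat) : nat :=
  if i is j.+1 then minn (b j) (c j) + maxn (b i) (c i) - d j else maxn (b 0) (c 0) + m.

Lemma rule_downP a b c : interlace a b -> interlace a c ->
  [/\ interlace b (rule_down a b c), interlace c (rule_down a b c) &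
      growth_rule a b c (rule_down a b c) (a 0 - maxn (b 0) (c 0))].
Proof.
rewrite /rule_down => ab ac; split=> [i|i|].
- have := ab i; have := ac i; have := ab i.+1; have := ac i.+1; lia.
- have := ab i; have := ac i; have := ab i.+1; have := ac i.+1; lia.
split=> [|i]; first by have := ab 0; have := ac 0; lia.
by have := ab i; have := ac i; have := ab i.+1; have := ac i.+1; lia.
Qed.

Lemma rule_upP d b c m : interlace b d -> interlace c d ->
  [/\ interlace (rule_up d b c m) b, interlace (rule_up d b c m) c &
      growth_rule (rule_up d b c m) b c d m].
Proof.
move=> bd cd; split=> [i|i|].
- have := bd i; have := cd i; case: i => [|i] /=; last have := bd i; last have := cd i; lia.
- have := bd i; have := cd i; case: i => [|i] /=; last have := bd i; last have := cd i; lia.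
split=> // i /=; have := bd i; have := cd i; lia.
Qed.

(* Row 0 of the diagram L carries the diagonals of p on and above the main
   diagonal, column 0 those on and below it. *)
Definition rsk (p A : array) : Prop :=
  exists N L, [/\ vanishing N L, growth L (fun r k => A (r, k)),
    forall k i, L 0 k i = p (i, i + k) & forall r i, L r 0 i = p (i + r, i)].

Lemma array_bound (p : array) : exists N, forall i j, N <= maxn i j -> p (i, j) = 0.
Proof.
exists (\sum_(x <- finsupp p) (maxn x.1 x.2).+1) => i j leN.
apply: fsfun_dflt; apply/negP => ps; move: leN.
rewrite (big_rem (i, j)) //=; lia.
Qed.

Lemma box_array (N : nat) (f : nat -> nat -> nat) :
  (forall i j, N <= maxn i j -> f i j = 0) -> exists p : array, forall i j, p (i, j) = f i j.
Proof.
move=> f0.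
pose B := [fset (nat_of_ord x.1, nat_of_ord x.2) | x in {: 'I_N * 'I_N}]%fset.
exists [fsfun x in B => f x.1 x.2 | 0] => i j; rewrite fsfunE /=.
case: ifPn => // /negP nB; rewrite f0 // leqNgt; apply/negP => lt; apply: nB.
have li : i < N by lia.
have lj : j < N by lia.
by apply/imfsetP; exists (Ordinal li, Ordinal lj).
Qed.

(** The diagonals of [p] serve as row 0 and column 0, [rule_down] fills the diagram outwards, and
    the entries are read off from the first parts. *)
Lemma rsk_total (p : array) : plane_partition p -> exists A, rsk p A.
Proof.
move=> pp; have [N p0] := array_bound p.
pose L := grid (fun _ _ => rule_down) (fun k i => p (i, i + k)) (fun r i => p (i + r, i)).
have Lrow k i : L 0 k i = p (i, i + k) by [].
have Lcol r i : L r 0 i = p (i + r, i) by case: r => //=; rewrite Lrow addn0.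
have ppS i j : p (i.+1, j) <= p (i, j) by have := pp i j 1 0; rewrite addn1 addn0.
have ppS' i j : p (i, j.+1) <= p (i, j) by have := pp i j 0 1; rewrite addn1 addn0.
(* Vertical interlacing below row [r] needs only horizontal interlacing in row [r], so the two kinds
   are proved alternately, row by row. *)
have vert r : (forall k, interlace (L r k) (L r k.+1)) ->
    forall k, interlace (L r k) (L r.+1 k).
  move=> hr; elim=> [i|k IH].
    by rewrite !Lcol addnS; split=> //; rewrite addSn -addnS ppS'.
  by have [] := rule_downP IH (hr k).
have horiz r k : interlace (L r k) (L r k.+1).
  elim: r k => [k i|r IH k]; first by rewrite !Lrow !addnS; split=> //; rewrite addSn ppS.
  by have [] := rule_downP (vert r IH k) (IH k).
pose m r k := L r k 0 - maxn (L r.+1 k 0) (L r k.+1 0).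
have gL : growth L m.
  move=> r k; split; [exact: vert | exact: horiz |].
  by have [] := rule_downP (vert r (horiz r) k) (horiz r k).
have vL : vanishing N L.
  (* First parts decrease along both directions, so they are bounded by boundary entries of [p],
     which vanish from [N] on. *)
  move=> r k leN; apply/eqP; rewrite -leqn0; case: (leqP N r) => lr.
    have le : L r k 0 <= L r 0 0.
      by elim: k {leN} => // k IH; apply: leq_trans IH; have [] := horiz r k 0.
    by apply: leq_trans le _; rewrite Lcol p0 //; lia.
  have le : L r k 0 <= L 0 k 0.
    elim: r {leN lr} => // r IH; apply: leq_trans IH.
    by have [] := vert r (horiz r) k 0.
  by apply: leq_trans le _; rewrite Lrow p0 //; lia.
have [r k leN|A AE] := @box_array N m; first by rewrite /m vL.
exists A, N, L; split=> // r k; rewrite AE; exact: gL.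
Qed.

(** Start from empty partitions beyond the support of [A] and apply [rule_up] towards the origin;
    row 0 and column 0 of the result are the diagonals of [p]. *)
Lemma rsk_surj (A : array) : exists2 p, plane_partition p & rsk p A.
Proof.
have [N A0] := array_bound A.
(* [grid] runs away from its boundary, so coordinates are reversed: [M a b] sits at vertex (N - a, N
   - b). The step receives [M a.+1 b] as [x], which after reversal is the corner [c] of the rule;
   hence the swap of [x] and [y]. *)
pose M := grid (fun a b d x y => rule_up d y x (A (N - a.+1, N - b.+1)))
   (fun _ _ => 0) (fun _ _ => 0).
pose L r k := M (N - r) (N - k).
have M0 b i : M 0 b i = 0 by [].
have M0' a i : M a 0 i = 0 by case: a.
have vert a : (forall b, interlace (M a b.+1) (M a b)) ->
    forall b, interlace (M a.+1 b) (M a b).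
  move=> ha; elim=> [i|b IH]; first by rewrite !M0'.
  by have [] := rule_upP (A (N - a.+1, N - b.+1)) (ha b) IH.
have horiz a b : interlace (M a b.+1) (M a b).
  elim: a b => [b i|a IH b]; first by rewrite !M0.
  by have [] := rule_upP (A (N - a.+1, N - b.+1)) (IH b) (vert a IH b).
have gL : growth L (fun r k => A (r, k)).
  have L0 r k i : N <= maxn r k -> L r k i = 0.
    by move=> leN; rewrite /L; have [/eqP->|/eqP->] : (N - r == 0) \/ (N - k == 0) by lia.
  move=> r k; case: (leqP N (maxn r k)) => [leN|ltN].
    by rewrite A0 //; split=> [i|i|]; [ | |split=> [|i]]; rewrite !L0 //; lia.
  have er : N - r = (N - r.+1).+1 by lia.
  have ek : N - k = (N - k.+1).+1 by lia.
  have [h1 h2 h3] := rule_upP (A (r, k)) (horiz (N - r.+1) (N - k.+1))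
    (vert _ (horiz _) (N - k.+1)).
  rewrite /L er ek; suff -> : M (N - r.+1).+1 (N - k.+1).+1 = rule_up (M (N - r.+1) (N - k.+1))
    (M (N - r.+1) (N - k.+1).+1) (M (N - r.+1).+1 (N - k.+1)) (A (r, k)) by [].
  by rewrite [LHS]gridS -er -ek !subKn //; lia.
have vL : vanishing N L.
  by move=> r k leN; rewrite /L; have [/eqP->|/eqP->] : (N - r == 0) \/ (N - k == 0) by lia.
(* Truncation makes one of [i - j], [j - i] zero, so this reads row 0 on and above the main diagonal
   and column 0 on and below it. *)
have [i j leN|p pE] := @box_array N (fun i j => L (i - j) (j - i) (minn i j)).
  by apply: (vanishing_entry gL vL); lia.
have row k i : L 0 k i = p (i, i + k) by rewrite pE; congr (L _ _ _); lia.
have col r i : L r 0 i = p (i + r, i) by rewrite pE; congr (L _ _ _); lia.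
exists p; last by exists N, L.
(* Each descent is one of the two inequalities in the interlacing of neighbouring diagonals; which
   one depends on the side of the main diagonal. *)
have ppS i j : p (i.+1, j) <= p (i, j).
  case: (leqP j i) => le.
    have [+ _ _] := gL (i - j) 0 => /(_ j)[+ _].
    rewrite !col; have -> : j + (i - j).+1 = i.+1 by lia.
    by have -> : j + (i - j) = i by lia.
  have [_ + _] := gL 0 (j - i.+1) => /(_ i)[_ +].
  rewrite !row; have -> : i.+1 + (j - i.+1) = j by lia.
  by have -> : i + (j - i.+1).+1 = j by lia.
have ppS' i j : p (i, j.+1) <= p (i, j).
  case: (leqP i j) => le.
    have [_ + _] := gL 0 (j - i) => /(_ i)[+ _].
    rewrite !row; have -> : i + (j - i).+1 = j.+1 by lia.
    by have -> : i + (j - i) = j by lia.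
  have [+ _ _] := gL (i - j.+1) 0 => /(_ j)[_ +].
  rewrite !col; have -> : j.+1 + (i - j.+1) = i by lia.
  by have -> : j + (i - j.+1).+1 = i by lia.
move=> i j a b; apply: (@leq_trans (p (i, j + b))).
  by elim: a => [|a]; rewrite ?addn0 // addnS; apply: leq_trans.
by elim: b => [|b]; rewrite ?addn0 // addnS; apply: leq_trans.
Qed.

(* [lia] fails on goals with big operators unless these are generalized. *)
Ltac sum_lia :=
  repeat match goal with
  | H : context [@bigop.body ?R ?I ?x ?r ?F] |- _ => move: H
  end;
  repeat match goal with
  | |- context [@bigop.body ?R ?I ?x ?r ?F] => move: (@bigop.body R I x r F) => ?
  end; nia.

Lemma vanishing_le N N' L : N <= N' -> vanishing N L -> vanishing N' L.
Proof. by move=> le vL r k le'; apply: vL; apply: leq_trans le'. Qed.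

Lemma rsk_injl p p' A : rsk p A -> rsk p' A -> p = p'.
Proof.
move=> [N [L [vL gL row col]]] [N' [L' [vL' gL' row' col']]].
have LL' := growth_unique_matrix gL gL' (vanishing_le (leq_maxl N N') vL)
  (vanishing_le (leq_maxr N N') vL').
apply/fsfunP => -[i j]; case: (leqP i j) => [le|/ltnW le].
  by rewrite -(subnKC le) -row -row' LL'.
by rewrite -(subnKC le) -col -col' LL'.
Qed.

Lemma rsk_injr p A A' : rsk p A -> rsk p A' -> A = A'.
Proof.
move=> [N [L [_ gL row col]]] [N' [L' [_ gL' row' col']]]; apply/fsfunP => -[r k].
by apply: (growth_unique_boundary gL gL') => *; rewrite ?row ?row' ?col ?col'.
Qed.

(** * Transport of the three weights through the correspondence *)

Lemma sum_finsupp (V : nmodType) (A : array) (N : nat) (F : nat * nat -> V) :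
  (forall i j, N <= maxn i j -> A (i, j) = 0) -> (forall x, A x = 0 -> F x = 0%R) ->
  (\sum_(x <- finsupp A) F x = \sum_(i < N) \sum_(j < N) F (i : nat, j : nat))%R.
Proof.
move=> A0 F0; pose s := [seq (i, j) | i <- index_iota 0 N, j <- index_iota 0 N].
have -> : (\sum_(i < N) \sum_(j < N) F (i : nat, j : nat) = \sum_(x <- s) F x)%R.
  rewrite big_allpairs_dep big_mkord; apply: eq_bigr => i _.
  by rewrite big_mkord.
rewrite [RHS](bigID (fun x => x \in finsupp A)) /= [X in (_ + X)%R]big1 ?addr0; last first.
  by move=> x /fsfun_dflt/F0.
rewrite -[RHS]big_filter; apply: perm_big; apply: uniq_perm.
- exact: fset_uniq.
- by rewrite filter_uniq // allpairs_uniq ?iota_uniq // => -[? ?] [? ?].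
move=> [i j]; rewrite mem_filter; case xA: (_ \in finsupp A) => //=; apply/esym.
apply/allpairsP; exists (i, j); rewrite !mem_index_iota; split=> //=.
  by rewrite ltnNge; apply/negP => le; move: xA; rewrite mem_finsupp A0 //; lia.
by rewrite ltnNge; apply/negP => le; move: xA; rewrite mem_finsupp A0 //; lia.
Qed.

(** Since min + max is the sum, adding up the rule telescopes; once the entries at [n] vanish it
    reads |a| + |d| = |b| + |c| + m. *)
Lemma growth_rule_sum a b c d m n : growth_rule a b c d m ->
  \sum_(i < n) a i + \sum_(i < n) d i + a n =
  \sum_(i < n) b i + \sum_(i < n) c i + m + maxn (b n) (c n).
Proof.
case=> e0 eS; elim: n => [|n IH]; first by rewrite !big_ord0; lia.
rewrite !big_ord_recr /=; have := eS n; sum_lia.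
Qed.

Lemma sum_shift (N i : nat) (f : nat -> nat) : (forall j, N <= j -> f j = 0) ->
  \sum_(j < N | i < j) f j = \sum_(k < N) f (i + k.+1).
Proof.
move=> f0; transitivity (\sum_(i.+1 <= j < N + i.+1) f j); last first.
  rewrite -{1}[i.+1]add0n big_addn addnK big_mkord.
  by apply: eq_bigr => k _; congr f; lia.
rewrite (@big_nat_widenl _ _ _ i.+1 0) // (@big_cat_nat _ _ _ N) ?leq_addr //=.
rewrite [X in _ + X]big1_seq ?addn0 ?big_mkord // => j.
by rewrite mem_index_iota => /andP[_ /andP[/f0]].
Qed.

(** Summation by parts: the drop [c k] is counted once in each of u 0, ..., u k, hence k times from
    u 1 on. *)
Lemma abel_sum (u c : nat -> nat) n : (forall k, u k = u k.+1 + c k) ->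
  u 0 = \sum_(k < n) c k + u n /\
  \sum_(k < n) u k.+1 = \sum_(k < n) k * c k + n * u n.
Proof.
move=> uE; elim: n => [|n [IH1 IH2]]; first by rewrite !big_ord0; lia.
rewrite !big_ord_recr /= IH2; have := uE n; split; sum_lia.
Qed.

(** With [D r k] the size of the partition at (r, k), telescoping the size identity over r shows
    that consecutive diagonal sums D 0 k and D 0 (k+1) of [p] differ by the sum of A (r, k) over r.
    Summation by parts turns this into the factor k; the other side is symmetric. *)
Lemma rsk_weights p A : rsk p A ->
  [/\ wminus p = \sum_(x <- finsupp A) x.2 * A x,
      wzero p = \sum_(x <- finsupp A) A x &
      wplus p = \sum_(x <- finsupp A) x.1 * A x].
Proof.
move=> [N1 [L [vL1 gL row col]]].
have [N2 p02] := array_bound p; have [N3 A03] := array_bound A.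
pose N := maxn N1 (maxn N2 N3).
have vL : vanishing N L by apply: vanishing_le vL1; rewrite /N; lia.
have p0 i j : N <= maxn i j -> p (i, j) = 0 by move=> le; apply: p02; lia.
have A0 i j : N <= maxn i j -> A (i, j) = 0 by move=> le; apply: A03; lia.
pose D r k := \sum_(i < N) L r k i.
have D0 r k : N <= maxn r k -> D r k = 0.
  by move=> le; apply: big1 => i _; rewrite (vanishing_entry gL vL) //; lia.
have DE r k : D r k + D r.+1 k.+1 = D r.+1 k + D r k.+1 + A (r, k).
  have [_ _ /(growth_rule_sum N)] := gL r k.
  by rewrite !(vanishing_entry gL vL _) ?maxn0 ?addn0 //; lia.
have Drow k : D 0 k = D 0 k.+1 + \sum_(r < N) A (r : nat, k).
  have : forall n, D 0 k + D n k.+1 = D 0 k.+1 + D n k + \sum_(r < n) A (r : nat, k).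
    elim=> [|n IH]; first by rewrite big_ord0; lia.
    by rewrite big_ord_recr /=; have := DE n k; sum_lia.
  by move=> /(_ N); rewrite !(D0 N); sum_lia.
have Dcol r : D r 0 = D r.+1 0 + \sum_(k < N) A (r, k : nat).
  have : forall n, D r 0 + D r.+1 n = D r.+1 0 + D r n + \sum_(k < n) A (r, k : nat).
    elim=> [|n IH]; first by rewrite big_ord0; lia.
    by rewrite big_ord_recr /=; have := DE r n; sum_lia.
  by move=> /(_ N); rewrite !(D0 _ N); sum_lia.
have [row0 row1] := abel_sum N Drow; have [_ col1] := abel_sum N Dcol.
rewrite !(D0 0 N) ?(D0 N 0) ?muln0 ?addn0 in row0 row1 col1; try lia.
split.
- rewrite /wminus big_mkcond (sum_finsupp (N := N)) // => [|x ->]; last by case: ifP.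
  rewrite (sum_finsupp (N := N)) // => [|x ->]; last by rewrite muln0.
  transitivity (\sum_(k < N) D 0 k.+1).
    rewrite [RHS]exchange_big /=; apply: eq_bigr => i _.
    rewrite -big_mkcond /= (@sum_shift N i (fun j => p (i : nat, j))); last first.
      by move=> *; apply: p0; lia.
    by apply: eq_bigr => k _; rewrite row.
  by rewrite row1 exchange_big; apply: eq_bigr => k _; rewrite big_distrr.
- rewrite /wzero big_mkcond (sum_finsupp (N := N)) // => [|x ->]; last by case: ifP.
  rewrite (sum_finsupp (N := N)) //.
  transitivity (D 0 0); last by rewrite row0 exchange_big.
  by apply: eq_bigr => i _; rewrite -big_mkcond /= (big_pred1 i) ?row ?addn0.
- rewrite /wplus big_mkcond (sum_finsupp (N := N)) // => [|x ->]; last by case: ifP.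
  rewrite (sum_finsupp (N := N)) // => [|x ->]; last by rewrite muln0.
  transitivity (\sum_(k < N) D k.+1 0).
    rewrite exchange_big [RHS]exchange_big /=; apply: eq_bigr => j _.
    rewrite -big_mkcond /= (@sum_shift N j (fun i => p (i, j : nat))); last first.
      by move=> *; apply: p0; lia.
    by apply: eq_bigr => k _; rewrite col addnC.
  by rewrite col1; apply: eq_bigr => k _; rewrite big_distrr.
Qed.

(** * The action of sl_2 *)

Local Open Scope ring_scope.

(* Functions B : P -> int are exponents of Laurent monomials x^B and functions
   phi : (P -> int) -> rat are coefficient families of formal Laurent series;
   [hop u v] is the operator x_v d/dx_u on these coefficients. *)
Definition transfer (P : eqType) (u v : P) (B : P -> int) : P -> int :=
  fun x => B x + (x == u)%:Z - (x == v)%:Z.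

Definition hop (P : eqType) (u v : P) (phi : (P -> int) -> rat) (B : P -> int) : rat :=
  (B u + 1)%:~R * phi (transfer u v B).

Definition hops (P : eqType) (I : finType) (c : I -> rat) (u v : I -> P)
    (phi : (P -> int) -> rat) (B : P -> int) : rat :=
  \sum_k c k * hop (u k) (v k) phi B.

Lemma transferC (P : eqType) (u v u' v' : P) B :
  transfer u v (transfer u' v' B) = transfer u' v' (transfer u v B).
Proof. by apply/funext => x; rewrite /transfer; ring. Qed.

Lemma transferK (P : eqType) (u v : P) B : transfer u v (transfer v u B) = B.
Proof. by apply/funext => x; rewrite /transfer; ring. Qed.

(** Hops with distinct indices commute: by injectivity neither differentiates the variable that the
    other multiplies by. Equal indices leave x_v d/dx_v - x_u d/dx_u. *)
Lemma hops_commutator (P : eqType) (I : finType) (c d : I -> rat) (u v : I -> P) phi B :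
  injective u -> injective v -> (forall k, u k != v k) ->
  hops c u v (hops d v u phi) B - hops d v u (hops c u v phi) B =
  (\sum_k c k * d k * (B (v k) - B (u k))%:~R) * phi B.
Proof.
move=> uI vI uv; rewrite /hops /hop.
under eq_bigr do rewrite !big_distrr /=.
under [X in _ - X]eq_bigr do rewrite !big_distrr /=.
rewrite [X in _ - X]exchange_big -sumrB big_distrl; apply: eq_bigr => k _.
rewrite -sumrB (bigD1 k) //= big1 ?addr0 => [|l lk].
  rewrite !transferK /transfer !eqxx eq_sym (negPf (uv k)) /=.
  ring.
rewrite [transfer (v l) _ (transfer _ _ _)]transferC /transfer.
rewrite !(inj_eq vI) !(inj_eq uI) (negPf lk) [k == l]eq_sym (negPf lk) (eq_sym (v l)).
(* If [u k] is [v l], both hops differentiate in the same variable, and either order yields the same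
   two factors. *)
by case: (eqVneq (u k) (v l)) => [->|_] /=; ring.
Qed.

(** * The two gradings and the sl_2 relation *)

Definition box_sum (N : nat) (f : nat -> nat -> int) (B : nat * nat -> int) : int :=
  \sum_(i < N) \sum_(j < N) B (i : nat, j : nat) * f i j.

Lemma box_sum_transfer N f u v B : (u.1 < N)%N -> (u.2 < N)%N -> (v.1 < N)%N -> (v.2 < N)%N ->
  box_sum N f (transfer u v B) = box_sum N f B + f u.1 u.2 - f v.1 v.2.
Proof.
move=> u1 u2 v1 v2.
have ind (w : nat * nat) : (w.1 < N)%N -> (w.2 < N)%N ->
    \sum_(i < N) \sum_(j < N) ((i : nat, j : nat) == w)%:Z * f i j = f w.1 w.2.
  case: w => a b /= la lb; rewrite (bigD1 (Ordinal la)) //=.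
  rewrite (bigD1 (Ordinal lb)) //= eqxx mul1r.
  rewrite big1 => [|j jb]; last first.
    rewrite xpair_eqE eqxx; case: eqP => [e|_]; last by rewrite mul0r.
    by case/eqP: jb; apply: val_inj.
  rewrite big1 ?addr0 // => i ia; apply: big1 => j _.
  by rewrite xpair_eqE; case: eqP => [e|_]; [case/eqP: ia; apply: val_inj | rewrite mul0r].
rewrite -(ind u) // -(ind v) // /box_sum -big_split -sumrB /=; apply: eq_bigr => i _.
by rewrite -big_split -sumrB /=; apply: eq_bigr => j _; rewrite /transfer; ring.
Qed.

Definition spin (N : nat) : (nat * nat -> int) -> int := box_sum N (fun i j => j%:Z - i%:Z).
Definition level (N : nat) : (nat * nat -> int) -> int :=
  box_sum N (fun i j => i%:Z + j%:Z + 1).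

(** The support lies in a triangle and not in a box because moves along antidiagonals preserve the
    triangle. *)
Definition state (N : nat) (n w : int) (B : nat * nat -> int) : Prop :=
  [/\ forall x, 0 <= B x, forall x, (N <= x.1 + x.2)%N -> B x = 0,
      level N B = n & spin N B = w].

(** Nonnegativity of the transferred exponents only gives B u >= -1; the nonzero factor [B u + 1]
    excludes -1, so the operators never leave the polynomials. *)
Lemma state_transfer N n w u v B : (u.1 + u.2 = v.1 + v.2)%N -> u != v -> B u + 1 != 0 ->
  state N n w (transfer u v B) -> state N n (w + (v.2%:Z - v.1%:Z) - (u.2%:Z - u.1%:Z)) B.
Proof.
move=> uv nuv Bu [B0 Bbox lB sB].
have Bu0 : 0 <= B u by have := B0 u; rewrite /transfer eqxx (negPf nuv); lia.
have ltN : (u.1 + u.2 < N)%N.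
  rewrite ltnNge; apply/negP => /Bbox; rewrite /transfer eqxx (negPf nuv); lia.
have B0' x : 0 <= B x.
  by have := B0 x; rewrite /transfer; case: (eqVneq x u) => [->|_] //; case: (x == v); lia.
split=> //.
- move=> x lx; have := Bbox x lx; rewrite /transfer.
  have /negPf-> : x != u by apply: contraTneq lx => ->; rewrite -ltnNge.
  have /negPf-> : x != v by apply: contraTneq lx => ->; rewrite -ltnNge -uv.
  by rewrite addr0 subr0.
- by rewrite -lB /level box_sum_transfer; lia.
- by rewrite -sB /spin box_sum_transfer; lia.
Qed.

Lemma state_spin_le N n w B : state N n w B -> w <= n.
Proof.
move=> [B0 _ <- <-]; rewrite ler_sum // => i _; rewrite ler_sum // => j _.
by apply: ler_wpM2l => //; lia.
Qed.

(** The coefficients are those of v d/du (u^(i+1) v^j) = (i+1) u^i v^(j+1), and symmetrically for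
    [lower]. *)
Definition raise N := hops (fun k : 'I_N * 'I_N => k.1.+1%:R)
  (fun k => (k.1.+1, k.2 : nat)) (fun k => (k.1 : nat, k.2.+1)).
Definition lower N := hops (fun k : 'I_N * 'I_N => k.2.+1%:R)
  (fun k => (k.1 : nat, k.2.+1)) (fun k => (k.1.+1, k.2 : nat)).

Definition homogeneous N n w (phi : (nat * nat -> int) -> rat) : Prop :=
  forall B, phi B != 0 -> state N n w B.

Lemma hops_neq0 (P : eqType) (I : finType) (c : I -> rat) (u v : I -> P) phi B :
  hops c u v phi B != 0 -> exists2 k, B (u k) + 1 != 0 & phi (transfer (u k) (v k) B) != 0.
Proof.
apply: contra_neqP => H; apply: big1 => k _; rewrite /hop.
case: (eqVneq (B (u k) + 1) 0) => [->|nz]; first by rewrite mul0r mulr0.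
case: (eqVneq (phi (transfer (u k) (v k) B)) 0) => [->|nz']; first by rewrite !mulr0.
by case: H; exists k.
Qed.

Lemma raise_homogeneous N n w phi :
  homogeneous N n w phi -> homogeneous N n (w + 2) (raise N phi).
Proof.
move=> hphi B /hops_neq0[[i j] /= Bu /hphi sB].
have := state_transfer _ _ Bu sB.
have -> : w + ((i : nat, j.+1).2%:Z - (i : nat, j.+1).1%:Z) -
  ((i.+1, j : nat).2%:Z - (i.+1, j : nat).1%:Z) = w + 2 by rewrite /=; lia.
by apply=> /=; [lia | apply/eqP => -[]; lia].
Qed.

Lemma lower_homogeneous N n w phi :
  homogeneous N n (w + 2) phi -> homogeneous N n w (lower N phi).
Proof.
move=> hphi B /hops_neq0[[i j] /= Bu /hphi sB].
have := state_transfer _ _ Bu sB.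
have -> : w + 2 + ((i.+1, j : nat).2%:Z - (i.+1, j : nat).1%:Z) -
  ((i : nat, j.+1).2%:Z - (i : nat, j.+1).1%:Z) = w by rewrite /=; lia.
by apply=> /=; [lia | apply/eqP => -[]; lia].
Qed.

(** The relation [E, F] = H. The commutator acts by the sum of (i+1)(j+1)(B(i, j+1) - B(i+1, j));
    shifting indices leaves ((i+1)j - i(j+1)) B(i, j) = (j - i) B(i, j). *)
Lemma raise_lower N n w phi B : homogeneous N n w phi ->
  raise N (lower N phi) B - lower N (raise N phi) B = w%:~R * phi B.
Proof.
move=> hphi; rewrite /raise /lower hops_commutator; first last.
- by move=> k; apply/eqP => -[]; lia.
- by move=> [i j] [i' j'] [/val_inj-> /val_inj->].
- by move=> [i j] [i' j'] [/val_inj-> /val_inj->].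
case: (eqVneq (phi B) 0) => [->|/hphi[_ Bbox _ <-]]; first by rewrite !mulr0.
congr (_ * _); rewrite -(pair_bigA _ (fun i j : 'I_N => i.+1%:R * j.+1%:R *
  (B (i : nat, j.+1) - B (i.+1, j : nat))%:~R)) /=.
(* At index [N] the summand vanishes by the support condition, at 0 by its factor [j] or [i]. *)
have shift (f : nat -> int) : f N = 0 -> \sum_(j < N) f j.+1 = \sum_(j < N) f j - f 0%N.
  move=> fN; apply/eqP; rewrite eq_sym subr_eq addrC; apply/eqP.
  by rewrite -(big_ord_recl N (fun j => f (val j))) big_ord_recr /= fN addr0.
transitivity ((\sum_(i < N) \sum_(j < N) i.+1%:Z * (j.+1%:Z * B (i : nat, j.+1)) -
   \sum_(j < N) \sum_(i < N) j.+1%:Z * (i.+1%:Z * B (i.+1, j : nat)))%:~R : rat).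
  rewrite [X in (_ - X)%:~R]exchange_big -sumrB rmorph_sum; apply: eq_bigr => i _.
  rewrite -sumrB rmorph_sum; apply: eq_bigr => j _.
  rewrite !rmorphB !rmorphM /=; ring.
congr (_%:~R).
have -> : \sum_(i < N) \sum_(j < N) i.+1%:Z * (j.+1%:Z * B (i : nat, j.+1)) =
   \sum_(i < N) \sum_(j < N) i.+1%:Z * (j%:Z * B (i : nat, j : nat)).
  apply: eq_bigr => i _; rewrite (shift (fun j => i.+1%:Z * (j%:Z * B (i : nat, j)))).
    by rewrite mul0r mulr0 subr0.
  by rewrite Bbox ?mulr0 //= leq_addl.
have -> : \sum_(j < N) \sum_(i < N) j.+1%:Z * (i.+1%:Z * B (i.+1, j : nat)) =
   \sum_(j < N) \sum_(i < N) j.+1%:Z * (i%:Z * B (i : nat, j : nat)).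
  apply: eq_bigr => j _; rewrite (shift (fun i => j.+1%:Z * (i%:Z * B (i, j : nat)))).
    by rewrite mul0r mulr0 subr0.
  by rewrite Bbox ?mulr0 //= leq_addr.
rewrite [X in _ - X]exchange_big -sumrB; apply: eq_bigr => i _.
by rewrite -sumrB; apply: eq_bigr => j _; rewrite !intS; ring.
Qed.

(** * Injectivity of the lowering operator and the dimension bound *)

Lemma iter_raise_homogeneous N n w phi k :
  homogeneous N n w phi -> homogeneous N n (w + 2 * k%:Z) (iter k (raise N) phi).
Proof.
move=> hphi; elim: k => [|k IH]; first by rewrite mulr0 addr0.
have -> : w + 2 * k.+1%:Z = w + 2 * k%:Z + 2 by rewrite intS; ring.
exact: raise_homogeneous.
Qed.

Lemma hopsZ (P : eqType) (I : finType) (c : I -> rat) (u v : I -> P) a phi :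
  hops c u v (fun B => a * phi B) = (fun B => a * hops c u v phi B).
Proof.
by apply/funext => B; rewrite /hops big_distrr; apply: eq_bigr => k _; rewrite /hop /=; ring.
Qed.

(* A nonzero vector of positive weight
   killed by [lower] would generate under [raise] an infinite string. *)
Lemma lower_injective N n (w : int) phi : 0 < w -> homogeneous N n w phi ->
  (forall B, lower N phi B = 0) -> forall B, phi B = 0.
Proof.
move=> w0 hphi lphi.
(* The scalar is the sum of the weights w, w + 2, ..., w + 2k, by induction with [E, F] = H. *)
have ladder k : exists2 a : rat, 0 < a & forall B,
    lower N (iter k.+1 (raise N) phi) B = - a * iter k (raise N) phi B.
  elim: k => [|k [a a0 IH]].
    exists w%:~R => [|B]; first by rewrite ltr0z.
    (* Zero is written as a multiple of [phi] so that [hopsZ] applies. *)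
    have := raise_lower B hphi; have -> : lower N phi = fun B => 0 * phi B.
      by apply/funext => C; rewrite lphi mul0r.
    by rewrite /raise hopsZ mul0r sub0r mulNr => <-; rewrite opprK.
  have h := iter_raise_homogeneous (k := k.+1) hphi.
  exists (a + (w + 2 * k.+1%:Z)%:~R) => [|B].
    by rewrite addr_gt0 // ltr0z; lia.
  have := raise_lower B h.
  have -> : lower N (iter k.+1 (raise N) phi) = fun B => - a * iter k (raise N) phi B.
    exact/funext.
  rewrite {1}/raise hopsZ -/(raise N) -iterS => e.
  rewrite -[lower _ _ _]opprK.
  by rewrite -[- lower _ _ _](addKr (- a * iter k.+1 (raise N) phi B)) e; ring.
have descent k : (forall B, iter k (raise N) phi B = 0) -> forall B, phi B = 0.
  elim: k => // k IH h0; apply: IH => B; have [a a0 aE] := ladder k.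
  have := aE B; have -> : iter k.+1 (raise N) phi = fun B => 0 * phi B.
    by apply/funext => C; rewrite h0 mul0r.
  rewrite /lower hopsZ mul0r => /esym/eqP.
  by rewrite mulf_eq0 oppr_eq0 gt_eqF //= => /eqP.
(* After |n| raisings the weight w + 2|n| exceeds n, which [state_spin_le] forbids for a nonzero
   coefficient. *)
apply: (descent `|n|%N) => B; apply: contrapT => /eqP.
move=> /(iter_raise_homogeneous hphi)/state_spin_le; lia.
Qed.

(** A row vector killed by the matrix [M] of [lower] gives a [phi] with [lower N phi] zero at every
    [e1 t], hence everywhere, so [phi] is 0; injectivity of [e2] reads the vector off [phi]. Thus
    [M] has rank [a], at most its number [b] of columns. *)
Lemma card_state_le N n (w : int) a b
    (e2 : 'I_a -> nat * nat -> int) (e1 : 'I_b -> nat * nat -> int) :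
  0 < w + 2 -> injective e2 -> (forall s, state N n (w + 2) (e2 s)) ->
  (forall B, state N n w B -> exists t, B = e1 t) -> (a <= b)%N.
Proof.
move=> w0 e2I e2S e1S.
pose delta s (B : nat * nat -> int) : rat := (`[< B = e2 s >])%:R.
pose M : 'M[rat]_(a, b) := \matrix_(s, t) lower N (delta s) (e1 t).
suff /eqP <- : row_free M by apply: rank_leq_col.
rewrite -kermx_eq0; apply/eqP/row_matrixP => i; rewrite row0.
have /sub_kermxP : (row i (kermx M) <= kermx M)%MS by apply: row_sub.
move: (row i _) => x xM {i}.
pose phi B := \sum_s x ord0 s * delta s B.
have hphi : homogeneous N n (w + 2) phi.
  move=> B; apply: contra_neqP => nB; apply: big1 => s _.
  by rewrite /delta; case: asboolP => [e|_]; [case: nB; rewrite e | rewrite mulr0].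
have lphi B : lower N phi B = \sum_s x ord0 s * lower N (delta s) B.
  rewrite /lower /hops /hop /phi; under [RHS]eq_bigr do rewrite big_distrr /=.
  rewrite exchange_big; apply: eq_bigr => k _ /=.
  by rewrite !big_distrr; apply: eq_bigr => s _ /=; ring.
have phi0 : forall B, phi B = 0.
  apply: (lower_injective w0 hphi) => B; apply: contrapT => /eqP nz.
  have [t Bt] := e1S B (lower_homogeneous hphi nz); case/eqP: nz.
  move: xM => /rowP/(_ t); rewrite !mxE => xMt; rewrite lphi Bt -[RHS]xMt.
  by apply: eq_bigr => s _; rewrite mxE.
apply/rowP => s; rewrite mxE -[RHS](phi0 (e2 s)) /phi (bigD1 s) //= big1 ?addr0 => [|s' ne].
  by rewrite /delta asboolT // mulr1.
by rewrite /delta asboolF ?mulr0 // => /e2I e; case/eqP: ne.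
Qed.

(** * Counting *)

Local Open Scope nat_scope.

(** A nonzero entry at (i, j) adds at least i + j + 1 to the weight, so [n] itself can serve as the
    size of the triangle. *)
Lemma rsk_b0_set p A l n : plane_partition p -> rsk p A ->
  b0_set l n p <-> state n (Posz n) l (fun x => Posz (A x)).
Proof.
move=> pp /rsk_weights[em ez ep].
pose s2 := \sum_(x <- finsupp A) x.2 * A x.
pose s1 := \sum_(x <- finsupp A) x.1 * A x.
pose s0 := \sum_(x <- finsupp A) A x.
have sums : (forall x, n <= x.1 + x.2 -> A x = 0) ->
    level n (fun x => Posz (A x)) = Posz (s2 + s0 + s1) /\
    spin n (fun x => Posz (A x)) = (s2%:Z - s1%:Z)%R.
  move=> A0; have box f : box_sum n f (fun x => Posz (A x)) =
      (\sum_(x <- finsupp A) (A x)%:Z * f x.1 x.2)%R.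
    rewrite (@sum_finsupp _ _ n) // => [i j le|x ->]; last by rewrite mul0r.
    by apply: A0 => /=; lia.
  rewrite /level /spin !box /s0 /s1 /s2 !PoszD -!(big_morph Posz PoszD (erefl _)).
  rewrite !(big_morph Posz PoszD (erefl (Posz 0))) -sumrB -!big_split /=.
  by split; apply: eq_bigr => x _; rewrite !PoszM; ring.
split=> [[_ wn wl]|[_ A0 lA sA]].
  have A0 x : n <= x.1 + x.2 -> A x = 0.
    move=> le; apply: contraTeq le => nz.
    have xA : x \in finsupp A by rewrite mem_finsupp.
    rewrite -ltnNge -wn /weight em ez ep -!big_split (big_rem x) //=.
    have := nz; rewrite -lt0n; nia.
  have [lE sE] := sums (fun x h => A0 x h).
  split=> // [x h||]; first by rewrite A0.
    by rewrite lE -wn /weight em ez ep.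
  by rewrite sE -wl em ep.
have [|lE sE] := sums; first by move=> x /A0 [].
split=> //; first by apply/eqP; rewrite -eqz_nat -lA lE /weight em ez ep.
by rewrite -sA sE em ep.
Qed.

Theorem theorem2p7 (m n : nat) : (b0 (m%:Z + 2)%R n <= b0 m%:Z n)%N.
Proof.
(* Choice turns the relation [rsk] into a function, with an arbitrary value off the plane
   partitions. *)
have [a aP] : {a : array -> array & forall p, plane_partition p -> rsk p (a p)}.
  apply: (choice (P := fun p A => plane_partition p -> rsk p A)) => p.
  case: (pselect (plane_partition p)) => [/rsk_total[A]|npp].
    by exists A.
  by exists p.
have b0P l p : (p \in fset_set (b0_set l n)) = (p \in b0_set l n).
  by apply: in_fset_set; apply: finite_b0_set.
pose e l (s : 'I_(b0 l n)) x := Posz (a (nth [fsfun] (fset_set (b0_set l n)) s) x).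
have eP l (s : 'I_(b0 l n)) : b0_set l n (nth [fsfun] (fset_set (b0_set l n)) s).
  by apply: set_mem; rewrite -b0P mem_nth.
have pp l s := let: And3 h _ _ := eP l s in h.
apply: (@card_state_le n (Posz n) (Posz m) _ _ (@e _) (@e _)).
- by lia.
- move=> s s' ess; have as' : a (nth [fsfun] (fset_set (b0_set (m%:Z + 2)%R n)) s) =
      a (nth [fsfun] (fset_set (b0_set (m%:Z + 2)%R n)) s').
    by apply/fsfunP => x; have := congr1 (fun f => f x) ess; rewrite /e => -[].
  have := aP _ (pp _ s'); rewrite -as' => /(rsk_injl (aP _ (pp _ s))) /eqP.
  by rewrite nth_uniq ?fset_uniq // => /eqP /val_inj.
- by move=> s; apply: (rsk_b0_set _ _ (pp _ s) (aP _ (pp _ s))).1; apply: eP.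
move=> B sB; have [B0 Bbox _ _] := sB.
(* The exponents of a state are nonnegative, so absolute values turn [B] into an array without
   loss. *)
have [i j le|A AE] := @box_array n (fun i j => `|B (i, j)|%N).
  by rewrite Bbox //=; lia.
have BE : B = fun x => Posz (A x).
  by apply/funext => -[i j]; rewrite AE gez0_abs.
have [p ppp pA] := rsk_surj A.
have pb : b0_set m%:Z n p by apply/(rsk_b0_set _ _ ppp pA); rewrite -BE.
have pin : p \in fset_set (b0_set m%:Z n) by rewrite b0P; apply: mem_set.
have lt : index p (fset_set (b0_set m%:Z n)) < b0 m%:Z n by rewrite index_mem.
exists (Ordinal lt); rewrite BE /e /= nth_index //.
by rewrite (rsk_injr (aP _ ppp) pA).
Qed.
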